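(* Let $S$ be a numerical semigroup with multiplicity $m$. Order $\mathcal{I}_0(S)$ by inclusion. Then: (1) the maximum of $\mathcal{I}_0(S)$ is $\{0,\dots,m-1\}+S=\mathbb{N}$; (2) the minimum of $\mathcal{I}_0(S)$ is $S$; (3) the set of maximal elements of $\mathcal{I}_0(S)\setminus\{\mathbb{N}\}$ is $\big\{\{0,1,\dots,i-1,i+m,i+1,\dots,m-1\}+S : i\in\{1,\dots,m-1\}\big\}$; (4) the set of minimal elements of $\mathcal{I}_0(S)\setminus\{S\}$ is $\{\{0,f\}+S : f\in\mathrm{PF}(S)\}$; (5) the largest $t$ for which there exists a strictly ascending chain $I_0\subsetneq I_1\subsetneq\dots\subsetneq I_t$ of ideals of $\mathcal{I}_0(S)$ is the genus $\mathrm{g}(S)$.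
   Context: $\mathbb{N}$ denotes the non-negative integers. A numerical semigroup $S$ is a submonoid of $(\mathbb{N},+)$ with finite complement in $\mathbb{N}$. The multiplicity $m$ of $S$ is its smallest positive element. Its set of gaps is $\mathrm{G}(S)=\mathbb{N}\setminus S$ and its genus is $\mathrm{g}(S)=|\mathrm{G}(S)|$. The order $\le_S$ on $\mathbb{Z}$ is defined by $a\le_S b$ if and only if $b-a\in S$, and $\mathrm{PF}(S)$ (the pseudo-Frobenius numbers) is the set of maximal elements of $\mathrm{G}(S)$ with respect to $\le_S$. For a set $X$ of integers, $X+S=\{x+s: x\in X, s\in S\}$. $\mathcal{I}_0(S)=\{E\subseteq\mathbb{N}: E+S\subseteq E,\ \min(E)=0\}$ is the set of ideals of $S$ with minimum $0$. *)

(* Defs.v *)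
From mathcomp Require Import all_boot all_order all_algebra.
From mathcomp Require Import finmap.
From mathcomp Require Import mathcomp_extra boolp classical_sets functions.
From mathcomp Require Import cardinality.

Set Implicit Arguments.
Unset Strict Implicit.
Unset Printing Implicit Defensive.

Local Open Scope classical_set_scope.

Section OrderNotions.
Context {T : Type} (R : T -> T -> Prop).

Definition is_maximum (A : set T) (x : T) : Prop :=
  A x /\ forall y, A y -> R y x.

Definition is_minimum (A : set T) (x : T) : Prop :=
  A x /\ forall y, A y -> R x y.

Definition maximals (A : set T) : set T :=
  [set x | A x /\ forall y, A y -> R x y -> y = x].

Definition minimals (A : set T) : set T :=
  [set x | A x /\ forall y, A y -> R y x -> y = x].

End OrderNotions.

Definition le_nat (a b : nat) : Prop := (a <= b)%N.

Definition sumset (X Y : set nat) : set nat :=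
  [set (x + y)%N | x in X & y in Y].

Record numerical_semigroup (S : set nat) : Prop := NumericalSemigroup {
  numsg0 : S 0%N;
  numsgD : forall a b, S a -> S b -> S (a + b)%N;
  numsg_cofinite : finite_set (~` S)
}.

Definition is_multiplicity (S : set nat) (m : nat) : Prop :=
  is_minimum le_nat [set s | S s /\ (0 < s)%N] m.

Definition gaps (S : set nat) : set nat := ~` S.

(* [fset_set A] is a junk value unless [A] is finite; the gaps of a numerical
   semigroup are. *)
Definition genus (S : set nat) : nat := #|` fset_set (gaps S)|.

(* The subtraction is the one of int, not the truncated one of nat. *)
Definition le_numsg (S : set nat) (a b : int) : Prop :=
  exists2 s : nat, S s & (b - a)%R = s%:Z%R.

Definition pseudo_frobenius (S : set nat) : set nat :=
  maximals (fun a b : nat => le_numsg S a%:Z b%:Z) (gaps S).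

Definition ideals0 (S : set nat) : set (set nat) :=
  [set E | sumset E S `<=` E /\ is_minimum le_nat E 0%N].

Definition ascending_chain (F : set (set nat)) (t : nat) (I : nat -> set nat)
  : Prop :=
  (forall k, (k <= t)%N -> F (I k)) /\
  (forall k, (k < t)%N -> I k `<` I k.+1).

(* Main.v *)
Require Import Defs.
From mathcomp Require Import all_boot all_order all_algebra.
From mathcomp Require Import finmap.
From mathcomp Require Import mathcomp_extra boolp classical_sets functions.
From mathcomp Require Import cardinality.
From mathcomp Require Import zify.

(** A gap missed by an ideal [E] can be reduced modulo [m], so [E] misses some
    [i < m]; the maximal proper ideals are thus the sets [N \ {i}].  Dually, the
    largest gap in an ideal [E <> S] is pseudo-Frobenius, so the minimal ideals
    above [S] are the sets [S U {f}].  Along a strict chain the number of gaps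
    in the ideal strictly increases, whence the bound [g(S)]; it is attained by
    adding the gaps to [S] one at a time, in decreasing order. *)

Set Implicit Arguments.
Unset Strict Implicit.
Unset Printing Implicit Defensive.

Local Open Scope classical_set_scope.

(** The entries satisfying [b] but not [a] are counted separately, and [x] is one of them. Applied
    to the list of gaps, this turns a strict inclusion of ideals into a strict growth of gap
    counts. *)
Lemma count_lt (T : eqType) (a b : pred T) (s : seq T) (x : T) :
  subpred a b -> x \in s -> b x -> ~~ a x -> (count a s < count b s)%N.
Proof.
move=> ab xs bx nax.
have -> : count b s = (count a s + count (predD b a) s)%N.
  rewrite -count_predUI [X in (_ + X)%N](@eq_count _ _ pred0) ?count_pred0 ?addn0.
    by apply: eq_count => y /=; case: (boolP (a y)) => // /ab ->.
  by move=> y /=; case: (a y).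
rewrite -addn1 leq_add2l -has_count; apply/hasP; exists x => //=.
by rewrite nax.
Qed.

Lemma ideals0P (S E : set nat) : ideals0 S E <->
  E 0%N /\ forall x s, E x -> S s -> E (x + s)%N.
Proof.
split=> [[ES [E0 _]]|[E0 ES]].
  by split=> // x s Ex Ss; apply: ES; exists x => //; exists s.
by split=> [_ [x Ex [s Ss <-]]|]; [exact: ES | split].
Qed.

Lemma ideals0_sub (S E : set nat) : ideals0 S E -> S `<=` E.
Proof. by move=> /ideals0P[E0 ES] s /(ES _ _ E0). Qed.

Section NumericalSemigroup.
Variables (S : set nat) (hS : numerical_semigroup S).

Lemma numsgM a k : S a -> S (k * a)%N.
Proof.
move=> Sa; elim: k => [|k IHk]; first exact: numsg0 hS.
by rewrite mulSn; exact: numsgD.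
Qed.

Lemma ideals0_numsg : ideals0 S S.
Proof. by apply/ideals0P; split; [exact: numsg0 hS | exact: numsgD]. Qed.

Lemma mem_gaps x : (x \in fset_set (gaps S)) = ~~ `[< S x >].
Proof.
rewrite in_fset_set; last exact: numsg_cofinite hS.
by apply/idP/idP => [/set_mem/asboolPn|/asboolPn/mem_set].
Qed.

Section Multiplicity.
Variables (m : nat) (hm : is_multiplicity S m).

Lemma sumset_iota : sumset [set k | (k < m)%N] S = [set: nat].
Proof.
case: hm => -[Sm m0] _; apply/seteqP; split=> // n _.
exists (n %% m)%N; first by rewrite /= ltn_pmod.
exists (n %/ m * m)%N; first exact: numsgM.
by rewrite addnC -divn_eq.
Qed.

Lemma numsg_ge s : S s -> (0 < s)%N -> (m <= s)%N.
Proof. by move=> Ss s0; apply: hm.2. Qed.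

(** Trading the generator [i] for [i + m] loses only [i]: nonzero elements of [S] are at least
    [m > i], so [i] could only arise as [i + 0]. *)
Lemma sumset_iotaD1 i : (0 < i < m)%N ->
  sumset ([set k | (k < m)%N] `\ i `|` [set (i + m)%N]) S = ~` [set i].
Proof.
case: (hm) => -[Sm m0] _ /andP[i0 im]; apply/seteqP; split.
  move=> _ [k hk [s Ss <-]] /= eqi.
  have [s0|s0] := posnP s; last by have := numsg_ge Ss s0; lia.
  by case: hk => [[_ /=]|/=]; lia.
move=> n /= ni; have n_eq := divn_eq n m.
have [ri|ri] := eqVneq (n %% m)%N i.
  exists (i + m)%N; first by right.
  (* Since [n <> i], the quotient is positive, and the generator [i + m] already accounts for one
     multiple of [m]. *)
  exists ((n %/ m).-1 * m)%N; first exact: numsgM.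
  by case: (n %/ m)%N n_eq => [|q]; rewrite ri ?mulSn /=; lia.
exists (n %% m)%N; first by left; split; [rewrite /= ltn_pmod|exact/eqP].
by exists (n %/ m * m)%N; [exact: numsgM|rewrite addnC -divn_eq].
Qed.

Lemma ideals0C1 i : (0 < i < m)%N -> ideals0 S (~` [set i]).
Proof.
move=> /andP[i0 im]; apply/ideals0P; split=> [/=|x s /= xi Ss]; first lia.
have [->|s0] := posnP s; first by rewrite addn0.
by have := numsg_ge Ss s0; lia.
Qed.

Lemma ideals0_proper_subC1 E : ideals0 S E -> E <> [set: nat] ->
  exists2 i, (0 < i < m)%N & E `<=` ~` [set i].
Proof.
case: hm => -[Sm m0] _ /ideals0P[E0 ES] ET.
have [n nE] : exists n, ~ E n.
  by apply/existsNP => allE; apply: ET; apply/seteqP; split.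
have nEr : ~ E (n %% m)%N.
  move=> Er; apply: nE; rewrite (divn_eq n m) addnC.
  by apply: ES => //; exact: numsgM.
exists (n %% m)%N; last by move=> x Ex /= xr; apply: nEr; rewrite -xr.
rewrite ltn_pmod // andbT lt0n; apply/eqP => r0.
by apply: nEr; rewrite r0.
Qed.

Lemma maximals_ideals0 : maximals subset (ideals0 S `\ [set: nat]) =
  [set ~` [set i] | i in [set i | (0 < i < m)%N]].
Proof.
have properC1 i : (0 < i < m)%N -> (ideals0 S `\ [set: nat]) (~` [set i]).
  by move=> im; split; [exact: ideals0C1|move=> /seteqP[_ /(_ i I)]; exact].
apply/seteqP; split=> [E [[IE ET] maxE]|_ [i im <-]].
  have [i im Ei] := ideals0_proper_subC1 IE ET.
  by exists i => //; apply: maxE => //; exact: properC1.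
split=> [|E [IE ET] iE]; first exact: properC1.
apply/seteqP; split=> // x Ex xi; apply: ET; apply/seteqP; split=> // y _.
by have [->|/eqP yi] := eqVneq y i; [rewrite -xi|exact: iE].
Qed.

End Multiplicity.

(** The elements strictly above [f] in the order of [S] are the [f + s] with [s > 0] in [S];
    maximality means that none of them is a gap. *)
Lemma pseudo_frobeniusP f : pseudo_frobenius S f <->
  ~ S f /\ forall s, S s -> (0 < s)%N -> S (f + s)%N.
Proof.
split=> [[Gf maxf]|[Gf fS]].
  split=> // s Ss s0; apply: contrapT => Gfs.
  suff : (f + s)%N = f by lia.
  by apply: maxf => //; exists s => //; lia.
split=> // y Gy [s Ss ys]; have {ys} yE : y = (f + s)%N by lia.
have [s0|s0] := posnP s; first by rewrite yE s0 addn0.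
by case: Gy; rewrite yE; exact: fS.
Qed.

Lemma sumset_pseudo_frobenius f : pseudo_frobenius S f ->
  sumset [set 0%N; f] S = f |` S.
Proof.
move=> /pseudo_frobeniusP[_ fS]; apply/seteqP; split.
  move=> _ [x [->|->] [s Ss <-]]; first by right.
  have [->|s0] := posnP s; first by left; rewrite addn0.
  by right; exact: fS.
move=> x [->|Sx].
  by exists f; [right|exists 0%N; [exact: numsg0 hS|rewrite addn0]].
by exists 0%N; [left|exists x].
Qed.

Lemma ideals0U1 f : pseudo_frobenius S f -> ideals0 S (f |` S).
Proof.
move=> /pseudo_frobeniusP[_ fS]; apply/ideals0P; split.
  by right; exact: numsg0 hS.
move=> x s [->|Sx] Ss; last by right; exact: numsgD.
have [->|s0] := posnP s; first by left; rewrite addn0.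
by right; exact: fS.
Qed.

(** Let [f] be the largest gap in [E]. For [s > 0] in [S], the sum [f + s] stays in [E] and exceeds
    [f], so it cannot be a gap. *)
Lemma ideals0_ex_pseudo_frobenius E : ideals0 S E -> E <> S ->
  exists2 f, pseudo_frobenius S f & E f.
Proof.
move=> IE ES; have /ideals0P[_ EDS] := IE.
pose P x := `[< E x /\ ~ S x >].
have exP : exists x, P x.
  apply: contrapT => /forallNP nP; apply: ES; apply/seteqP; split.
    by move=> x Ex; apply: contrapT => Sx; apply: (nP x); exact/asboolP.
  exact: ideals0_sub.
have ubP x : P x -> (x <= \max_(y <- fset_set (gaps S)) y)%N.
  move=> /asboolP[_ /asboolPn]; rewrite -mem_gaps => xG.
  exact: leq_bigmax_seq.
have [f /asboolP[Ef Gf] maxf] := ex_maxnP exP ubP.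
exists f => //; apply/pseudo_frobeniusP; split=> // s Ss s0.
apply: contrapT => Gfs; suff /maxf : P (f + s)%N by lia.
by apply/asboolP; split=> //; exact: EDS.
Qed.

Lemma minimals_ideals0 : minimals subset (ideals0 S `\ S) =
  [set f |` S | f in pseudo_frobenius S].
Proof.
have neqS f : pseudo_frobenius S f -> (ideals0 S `\ S) (f |` S).
  move=> PFf; split; first exact: ideals0U1.
  by move=> /seteqP[/(_ f (or_introl erefl))]; case: PFf.
apply/seteqP; split=> [E [[IE ES] minE]|_ [f PFf <-]].
  have [f PFf Ef] := ideals0_ex_pseudo_frobenius IE ES.
  exists f => //; apply: minE; first exact: neqS.
  by move=> x [->//|]; exact: ideals0_sub.
split=> [|E [IE ES] Ef]; first exact: neqS.
apply/seteqP; split=> // x [->|]; last exact: ideals0_sub.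
apply: contrapT => nEf; apply: ES; apply/seteqP; split; last exact: ideals0_sub.
by move=> y Ey; case: (Ef _ Ey) => // yf; case: nEf; rewrite -yf.
Qed.

Lemma ascending_chain_le_genus t I :
  ascending_chain (ideals0 S) t I -> (t <= genus S)%N.
Proof.
move=> [II ltI]; pose G := enum_fset (fset_set (gaps S)).
(* Induction on the chain: the ideal [I k] contains at least [k] gaps. *)
suff cntI k : (k <= t)%N -> (k <= count (fun x => `[< I k x >]) G)%N.
  by apply: leq_trans (cntI t (leqnn t)) _; exact: count_size.
elim: k => // k IHk kt; apply: leq_ltn_trans (IHk (ltnW kt)) _.
have [subI /existsNP[x /not_implyP[Ix nIx]]] := ltI _ kt.
apply: (@count_lt _ _ _ _ x).
- by move=> y /asboolP Iy; apply/asboolP; exact: subI.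
(* The new element [x] is a gap, because [I k] contains [S] and misses [x]. *)
- rewrite [_ \in _]mem_gaps; apply/asboolPn => Sx; apply: nIx.
  by apply: ideals0_sub Sx; apply: II; exact: ltnW.
- exact/asboolP.
- exact/asboolPn.
Qed.

Lemma genus_chain : exists I, ascending_chain (ideals0 S) (genus S) I.
Proof.
pose G := enum_fset (fset_set (gaps S)); pose c x := count (leq x) G.
have c_anti x y : (x <= y)%N -> (c y <= c x)%N.
  by move=> xy; apply: sub_count => z /=; exact: leq_trans.
have cS x : c x = (count_mem x G + c x.+1)%N.
  rewrite /c -count_predUI [X in (_ + X)%N](@eq_count _ _ pred0) ?count_pred0.
    by rewrite addn0; apply: eq_count => y /=; rewrite leq_eqVlt eq_sym.
  by move=> y /=; apply/negbTE; lia.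
(* [c x.+1] is the number of gaps strictly above [x], so the [k]-th ideal is [S] together with the
   [k] largest gaps. The second condition is upward closed, hence stable under adding elements of
   [S]. *)
exists (fun k x => S x \/ (c x.+1 < k)%N); split=> [k _|k kg].
  apply/ideals0P; split=> [|x s [Sx|cx] Ss]; first by left; exact: numsg0 hS.
    by left; exact: numsgD.
  by right; apply: leq_ltn_trans cx; apply: c_anti; lia.
have exc : exists x, (c x <= k)%N.
  (* No gap lies beyond the largest one. *)
  exists (\max_(y <- G) y).+1; rewrite (_ : c _ = 0%N) //.
  apply/eqP; rewrite -leqn0 leqNgt -has_count; apply/hasPn => y yG.
  by rewrite -leqNgt leq_bigmax_seq.
have [x cx minx] := ex_minnP exc.
(* The least value is not 0, as [c 0] is the genus, which exceeds [k]. Writing it [x.+1], the count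
   drops from above [k] to at most [k] at [x]; hence [x] is a gap with exactly [k] gaps above it,
   the one added at step [k.+1]. *)
case: x cx minx => [|x] cx minx.
  move: cx; rewrite /c (@eq_count _ _ predT) // count_predT.
  by rewrite leqNgt -[size _]/(genus S) kg.
have kcx : (k < c x)%N by rewrite ltnNge; apply/negP => /minx; lia.
have uG : uniq G by exact: fset_uniq.
move: kcx; rewrite cS count_uniq_mem //.
have [xG|_] := boolP (x \in G); last by rewrite ltnNge cx.
move=> kcx; split=> [y [Sy|cy]|le]; [by left|by right; exact: ltnW|].
move: xG; rewrite [_ \in _]mem_gaps => /asboolPn nSx.
by case: (le x); [right; lia|exact: nSx|lia].
Qed.

End NumericalSemigroup.

Theorem proposition4p17 (S : set nat) (m : nat)
    (hS : numerical_semigroup S) (hm : is_multiplicity S m) :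
  (is_maximum subset (ideals0 S) (sumset [set k | (k < m)%N] S) /\
     sumset [set k | (k < m)%N] S = [set: nat]) /\
  is_minimum subset (ideals0 S) S /\
  maximals subset (ideals0 S `\ [set: nat]) =
    [set sumset ([set k | (k < m)%N] `\ i `|` [set (i + m)%N]) S
       | i in [set i | (0 < i < m)%N]] /\
  minimals subset (ideals0 S `\ S) =
    [set sumset [set 0%N; f] S | f in pseudo_frobenius S] /\
  is_maximum le_nat [set t | exists I, ascending_chain (ideals0 S) t I]
    (genus S).
Proof.
split; first by rewrite (sumset_iota hS hm).
split; first by split; [exact: ideals0_numsg | exact: ideals0_sub].
split.
  rewrite (maximals_ideals0 hS hm); apply: eq_imagel => i im.
  by rewrite (sumset_iotaD1 hS hm).
split.
  rewrite (minimals_ideals0 hS); apply: eq_imagel => f PFf.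
  by rewrite (sumset_pseudo_frobenius hS).
split; first exact: genus_chain.
by move=> t [I]; exact: ascending_chain_le_genus.
Qed.
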